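(* Let $(a,b)$ be a bounded open interval with $0\in[a,b]$, let $q\in L^1(a,b)$ and $L=\frac{d^2}{dx^2}-q$. Let $T$ be a standard transmutation operator on $\mathcal{P}(\mathbb{R})$ corresponding to $L$. Then the operators $TP_+$, $TP_-$, $TAP_+$ and $T\frac{d}{dx}P_-$ are standard transmutation operators on $\mathcal{P}(\mathbb{R})$ corresponding to $L$ as well.
   Context: All functions are complex valued; $\mathbb{N}_0=\{0,1,2,\dots\}$; $\mathcal{P}(\mathbb{R})$ is the linear space of polynomials. Elements of $W^{2,1}(a,b)$ are identified with their $C^1[a,b]$ representatives. The operators $P_\pm u(x)=\frac{u(x)\pm u(-x)}{2}$ and $Au(x)=\int_0^x u(s)\,ds$ map $\mathcal{P}(\mathbb{R})$ into itself. A linear map $T$ defined on $\mathcal{P}(\mathbb{R})$ is a transmutation operator on $\mathcal{P}(\mathbb{R})$ corresponding to $L=\frac{d^2}{dx^2}-q$ if for every polynomial $u$ we have $Tu\in W^{2,1}(a,b)$ and $\left(\frac{d^2}{dx^2}-q\right)Tu=Tu''$. An $L$-base is a system $\{\varphi_k\}_{k\in\mathbb{N}_0}$ with $\varphi_k''-q\varphi_k=0$ for $k=0,1$ and $\varphi_k''-q\varphi_k=k(k-1)\varphi_{k-2}$ for $k\ge2$, in the sense of weak solutions (equivalently $\varphi_k\in W^{2,1}(a,b)$ and the equations hold a.e. on $(a,b)$). A standard $L$-base (s-$L$-base) is an $L$-base with $\varphi_k(0)=\varphi_k'(0)=0$ for all $k\ge2$. A transmutation operator $T$ on $\mathcal{P}(\mathbb{R})$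 is called standard (an s-transmutation) if $\{T[x^k]\}_{k\in\mathbb{N}_0}$ is an s-$L$-base. *)

(* Defs.v *)
(* MathComp-Analysis; the complex numbers are R[i] from mathcomp-real-closed. *)
From HB Require Import structures.
From mathcomp Require Import all_boot all_order all_algebra.
From mathcomp Require Import all_classical all_reals all_analysis.
From mathcomp Require Import complex.

Set Implicit Arguments.
Unset Strict Implicit.
Unset Printing Implicit Defensive.

Import Order.TTheory GRing.Theory Num.Theory.
Import numFieldNormedType.Exports.

Local Open Scope classical_set_scope.
Local Open Scope ring_scope.
Local Open Scope complex_scope.

(* Calculus for complex-valued functions of a real variable is done
   componentwise, since R[i] carries no normed R-module structure in the
   libraries. *)
Section ComplexCalculus.
Context {R : realType}.
Implicit Types (f u v : R -> R[i]) (D : set R).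

Definition re_fun f : R -> R := fun x => complex.Re (f x).
Definition im_fun f : R -> R := fun x => complex.Im (f x).

Definition cderivable f (x : R) : Prop :=
  derivable (re_fun f) x 1 /\ derivable (im_fun f) x 1.

Definition cderive f : R -> R[i] :=
  fun x => derive1 (re_fun f) x +i* derive1 (im_fun f) x.

Definition cderiven (n : nat) f : R -> R[i] := iter n cderive f.

Definition cintegrable D f : Prop :=
  (@lebesgue_measure R).-integrable D (EFin \o re_fun f) /\
  (@lebesgue_measure R).-integrable D (EFin \o im_fun f).

Definition cintegral D f : R[i] :=
  Rintegral (@lebesgue_measure R) D (re_fun f)
    +i* Rintegral (@lebesgue_measure R) D (im_fun f).

(* The oriented integral of f from x to y. *)
Definition ointegral (x y : R) f : R[i] :=
  if x <= y then cintegral `[x, y] f else - cintegral `[y, x] f.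

(* For x in D: the derivative at x of the restriction of f to D; it is
   one-sided when x is an endpoint of the interval D. *)
Definition has_derive_within D f (x : R) (l : R[i]) : Prop :=
  ((fun y => (re_fun f y - re_fun f x) / (y - x)) @ within D x^'
     --> complex.Re l) /\
  ((fun y => (im_fun f y - im_fun f x) / (y - x)) @ within D x^'
     --> complex.Im l).

Definition C1_on (a b : R) f : Prop :=
  exists g : R -> R[i],
    [/\ forall x, x \in `[a, b] -> has_derive_within `[a, b] f x (g x),
        {within `[a, b], continuous (re_fun g)} &
        {within `[a, b], continuous (im_fun g)}].

End ComplexCalculus.

Section Sobolev.
Context {R : realType}.
Variables (a b : R).
Implicit Types (u v w f g q phi : R -> R[i]).

Definition L1 f : Prop := cintegrable `]a, b[ f.

Definition test_function phi : Prop :=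
  (forall n x, cderivable (cderiven n phi) x) /\
  exists K : set R,
    [/\ compact K, K `<=` `]a, b[ & forall x, ~ K x -> phi x = 0].

Definition weak_derivative (k : nat) u v : Prop :=
  forall phi, test_function phi ->
    cintegral `]a, b[ (fun x => u x * cderiven k phi x)
    = (-1) ^+ k * cintegral `]a, b[ (fun x => v x * phi x).

(* Membership in W^{2,1}(a,b) of the C^1[a,b] representative u; the values of
   u outside [a,b] are irrelevant. *)
Definition W21 u : Prop :=
  [/\ C1_on a b u, L1 u, exists2 v, L1 v & weak_derivative 1 u v
    & exists2 w, L1 w & weak_derivative 2 u w].

(* (d^2/dx^2 - q) f = g a.e. on (a,b), with d^2/dx^2 the weak derivative. *)
Definition L_equation q f g : Prop :=
  exists w, [/\ L1 w, weak_derivative 2 f w &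
    {ae @lebesgue_measure R, forall x, x \in `]a, b[ ->
       w x - q x * f x = g x}].

Definition L_base q (phi : nat -> R -> R[i]) : Prop :=
  [/\ forall k, W21 (phi k),
      forall k, (k < 2)%N -> L_equation q (phi k) (fun=> 0) &
      forall k, (2 <= k)%N ->
        L_equation q (phi k) (fun x => (k * (k - 1))%N%:R * phi (k - 2)%N x)].

Definition standard_L_base q (phi : nat -> R -> R[i]) : Prop :=
  L_base q phi /\
  forall k, (2 <= k)%N ->
    phi k 0 = 0 /\ has_derive_within `[a, b] (phi k) 0 0.

End Sobolev.

Section Transmutation.
Context {R : realType}.
Implicit Types (u v q : R -> R[i]) (T : (R -> R[i]) -> (R -> R[i])).

(* The space P(R): polynomials with complex coefficients, as functions on R. *)
Definition polyfun u : Prop :=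
  exists p : {poly R[i]}, u = fun x => p.[x%:C].

Definition monomial (k : nat) : R -> R[i] := fun x => x%:C ^+ k.

Definition Pplus u : R -> R[i] := fun x => (u x + u (- x)) / 2.
Definition Pminus u : R -> R[i] := fun x => (u x - u (- x)) / 2.
Definition Aop u : R -> R[i] := fun x => ointegral 0 x u.

(* An operator on P(R) is a total map on functions of which only the values at
   polynomials matter; its results are functions on [a,b], so linearity is an
   identity on [a,b]. *)
Definition linear_on_polyfun (a b : R) T : Prop :=
  forall (c : R[i]) u v, polyfun u -> polyfun v ->
    forall x, x \in `[a, b] ->
      T (fun y => c * u y + v y) x = c * T u x + T v x.

Definition transmutation (a b : R) q T : Prop :=
  linear_on_polyfun a b T /\
  forall u, polyfun u ->
    W21 a b (T u) /\ L_equation a b q (T u) (T (cderiven 2 u)).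

Definition standard_transmutation (a b : R) q T : Prop :=
  transmutation a b q T /\ standard_L_base a b q (fun k => T (monomial k)).

End Transmutation.

(* Main.v *)
Require Import Defs.
From HB Require Import structures.
From mathcomp Require Import all_boot all_order all_algebra.
From mathcomp Require Import all_classical all_reals all_analysis.
From mathcomp Require Import complex.

Set Implicit Arguments.
Unset Strict Implicit.
Unset Printing Implicit Defensive.

Import Order.TTheory GRing.Theory Num.Theory.
Import numFieldNormedType.Exports.
Local Open Scope ring_scope.
Local Open Scope complex_scope.

(** Each of the four operators is T composed with a linear operator B of
    polynomials which commutes with the second derivative and maps x^k, for
    k >= 2, to a multiple of some x^m with m >= 2.  These two properties are
    all that is needed ([standard_transmutation_comp]).  Commutation carries
    the transmutation identity over from T to T B, since
    L T B u = T (B u)'' = T B u''.  The monomial property gives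
    T B x^k = c T x^m, which has vanishing Cauchy data at 0 because m >= 2.
    That the images of the monomials form an L-base is no extra condition: it
    is the transmutation identity at u = x^k.

    For the projections onto even and odd functions both properties are
    immediate.  For the even-part antiderivative and the derivative of the odd
    part the exponent moves by one, and parity does the work.  The
    antiderivative A alone does not commute with the second derivative, the
    defect being the value of u' at 0, which vanishes for even u.  The
    derivative alone sends x^2 to 2x, but x^2 is killed by the odd projection,
    and from x^3 on the exponent stays at least 2.

    Since derivatives and integrals of complex-valued functions are taken
    componentwise, the analytic input is that on polynomials they agree with
    the formal operations ([cderive_polyC], [ointegral_deriv]).  This is read
    off the real and imaginary parts of the coefficients; afterwards all
    computations take place in the ring of polynomials. *)

(** * Polynomials with complex coefficients as functions of a real variable *)

Section PolynomialFunctions.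
Context {R : realType}.
Implicit Types (p : {poly R[i]}) (r s : {poly R}) (x y : R).

Definition polyC_fun p : R -> R[i] := fun x => p.[x%:C].

Lemma polyC_fun_poly p : polyfun (polyC_fun p).
Proof. by exists p. Qed.

Lemma polyC_fun_linear (c : R[i]) p1 p2 :
  (fun x => c * polyC_fun p1 x + polyC_fun p2 x) = polyC_fun (c *: p1 + p2).
Proof. by apply/funext => x; rewrite /polyC_fun hornerD hornerZ. Qed.

Lemma monomialE k : @monomial R k = polyC_fun 'X^k.
Proof. by apply/funext => x; rewrite /polyC_fun hornerXn. Qed.

(** Writing p in this form turns its componentwise derivative and integral into
    those of the real polynomials r and s. *)
Definition ReIm_poly r s : {poly R[i]} :=
  map_poly (real_complex R) r + 'i *: map_poly (real_complex R) s.

(** The variable is real, so taking real and imaginary parts of the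
    coefficients splits the polynomial function as well. *)
Lemma ReIm_polyP p : exists r s, p = ReIm_poly r s.
Proof.
exists (map_poly (@complex.Re R) p), (map_poly (@complex.Im R) p).
apply/polyP => k; rewrite coefD coefZ !coef_map /=.
by rewrite [LHS]complexE.
Qed.

Lemma polyC_fun_ReIm r s x : polyC_fun (ReIm_poly r s) x = r.[x] +i* s.[x].
Proof.
by rewrite /polyC_fun hornerD hornerZ !horner_map /= [RHS]complexE.
Qed.

Lemma re_polyC_fun r s : re_fun (polyC_fun (ReIm_poly r s)) = horner r.
Proof. by apply/funext => x; rewrite /re_fun polyC_fun_ReIm. Qed.

Lemma im_polyC_fun r s : im_fun (polyC_fun (ReIm_poly r s)) = horner s.
Proof. by apply/funext => x; rewrite /im_fun polyC_fun_ReIm. Qed.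

Lemma deriv_ReIm_poly r s : (ReIm_poly r s)^`() = ReIm_poly r^`() s^`().
Proof. by rewrite derivD derivZ !deriv_map. Qed.

Lemma cderive_polyC p : cderive (polyC_fun p) = polyC_fun p^`().
Proof.
have [r [s ->]] := ReIm_polyP p; apply/funext => x.
by rewrite deriv_ReIm_poly polyC_fun_ReIm /cderive !derivE
  re_polyC_fun im_polyC_fun.
Qed.

Lemma cderiven2_polyC p : cderiven 2 (polyC_fun p) = polyC_fun p^`(2).
Proof. by rewrite /cderiven /= !cderive_polyC. Qed.

Lemma Rintegral_deriv r x y : x <= y ->
  Rintegral (@lebesgue_measure R) `[x, y] (horner r^`()) = r.[y] - r.[x].
Proof.
rewrite le_eqVlt => /predU1P[<-|xy].
  by rewrite set_itv1 Rintegral_set1 subrr.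
rewrite /Rintegral (@continuous_FTC2 _ _ (horner r)) //.
- exact/continuous_subspaceT/continuous_horner.
- split => [z _||]; first exact: derivable_horner.
  + exact/cvg_at_right_filter/continuous_horner.
  + exact/cvg_at_left_filter/continuous_horner.
- by move=> z _; rewrite derivE.
Qed.

Lemma ointegral_deriv p x y :
  ointegral x y (polyC_fun p^`()) = polyC_fun p y - polyC_fun p x.
Proof.
have [r [s ->]] := ReIm_polyP p.
rewrite deriv_ReIm_poly !polyC_fun_ReIm /ointegral /cintegral.
rewrite re_polyC_fun im_polyC_fun.
by case: leP => [xy|/ltW yx]; rewrite !Rintegral_deriv //; simpc;
  rewrite ?opprB.
Qed.

End PolynomialFunctions.

(** * The operators on the coefficients of polynomials *)

Section PolynomialOperators.
Context {F : numFieldType}.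
Implicit Types p : {poly F}.

Definition parity_part (e : bool) p : {poly F} :=
  \poly_(k < size p) (p`_k *+ (odd k == e)).

Lemma coef_parity_part e p k : (parity_part e p)`_k = p`_k *+ (odd k == e).
Proof.
rewrite coef_poly; case: ltnP => // /leq_sizeP/(_ k (leqnn k)) ->.
by rewrite mul0rn.
Qed.

Lemma parity_part_linear e : linear (parity_part e).
Proof.
move=> c p1 p2; apply/polyP => k.
by rewrite coefD coefZ !coef_parity_part coefD coefZ mulrnDl mulrnAr.
Qed.

Lemma parity_part_deriv e p : parity_part e p^`() = (parity_part (~~ e) p)^`().
Proof.
apply/polyP => k; rewrite coef_parity_part !coef_deriv coef_parity_part /=.
by rewrite mulrnAC (inj_eq negb_inj).
Qed.

Lemma parity_partXn e k : parity_part e 'X^k = (odd k == e)%:R *: 'X^k.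
Proof.
apply/polyP => l; rewrite coef_parity_part coefZ coefXn.
by case: eqP => [->|_]; rewrite ?mulr1 // mulr0 mul0rn.
Qed.

Lemma horner_parity_part e p x :
  (parity_part e p).[x] = (p.[x] + (-1) ^+ e * p.[- x]) / 2.
Proof.
rewrite (horner_coef_wide _ (size_poly _ _)) !horner_coef mulr_sumr.
rewrite -big_split /=.
rewrite mulr_suml; apply: eq_bigr => k _; rewrite coef_parity_part.
rewrite [(- x) ^+ _]exprNn -[(-1) ^+ k]signr_odd [p`_k * (_ * _)]mulrCA.
rewrite [_ * (_ * (_ * _))]mulrA -signr_addb mulrnAl -[X in X + _]mul1r -mulrDl.
have n2 : (2 : F) != 0 by rewrite pnatr_eq0.
case: e (odd k) => [] []; rewrite /= ?subrr ?mul0r ?mulr0n //.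
all: by rewrite mulr1n -[1 + 1]/2 mulrAC mulfV // mul1r.
Qed.

(** At k = 0 the divisor is 0, whose inverse is 0. *)
Definition antideriv p : {poly F} :=
  \poly_(k < (size p).+1) (p`_k.-1 / k%:R).

Lemma coef_antideriv p k : (antideriv p)`_k = p`_k.-1 / k%:R.
Proof.
rewrite coef_poly; case: ltnP => // kp.
by case: k kp => // k /leq_sizeP/(_ k (leqnn k)) ->; rewrite mul0r.
Qed.

Lemma antideriv_linear : linear antideriv.
Proof.
move=> c p1 p2; apply/polyP => k.
by rewrite coefD coefZ !coef_antideriv coefD coefZ mulrDl mulrA.
Qed.

Lemma antiderivZ c p : antideriv (c *: p) = c *: antideriv p.
Proof. by apply/polyP => k; rewrite coefZ !coef_antideriv coefZ mulrA. Qed.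

Lemma antiderivK p : (antideriv p)^`() = p.
Proof.
apply/polyP => k; rewrite coef_deriv coef_antideriv /=.
by rewrite -[LHS]mulr_natr mulfVK // pnatr_eq0.
Qed.

Lemma derivK p : p`_0 = 0 -> antideriv p^`() = p.
Proof.
move=> p0; apply/polyP => -[|k]; rewrite coef_antideriv ?invr0 ?mulr0 //=.
by rewrite coef_deriv -[p`_k.+1 *+ _]mulr_natr mulfK // pnatr_eq0.
Qed.

Lemma antiderivXn k : antideriv 'X^k = k.+1%:R^-1 *: 'X^(k.+1).
Proof.
apply/polyP => -[|l]; rewrite coef_antideriv coefZ !coefXn /= ?invr0 ?mulr0 //.
by rewrite eqSS; case: eqP => [->|_]; rewrite ?mulr1 ?mul1r ?mulr0 ?mul0r.
Qed.

(** The constant of integration lost by differentiating twice is the linear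
    coefficient of p, which is absent from the even part. *)
Lemma antideriv_even_derivn2 p :
  antideriv (parity_part false p^`(2)) = (antideriv (parity_part false p))^`(2).
Proof.
rewrite [RHS]derivnS derivn1 antiderivK !derivnS derivn0 !parity_part_deriv /=.
by rewrite derivK // coef_deriv coef_parity_part mulr0n mul0rn.
Qed.

End PolynomialOperators.

(** * Composing a standard transmutation with an operator of polynomials *)

Section Transmutation.
Context {R : realType}.
Variables (a b : R) (q : R -> R[i]) (T : (R -> R[i]) -> (R -> R[i])).

Lemma linear_on_polyfun0 x : linear_on_polyfun a b T -> x \in `[a, b] ->
  T (polyC_fun 0) x = 0.
Proof.
move=> Tlin xab.
have := Tlin 1 _ _ (polyC_fun_poly 0) (polyC_fun_poly 0) x xab.
rewrite polyC_fun_linear scaler0 addr0 mul1r.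
by move/eqP; rewrite -subr_eq subrr => /eqP.
Qed.

Lemma linear_on_polyfunZ c p x : linear_on_polyfun a b T -> x \in `[a, b] ->
  T (polyC_fun (c *: p)) x = c * T (polyC_fun p) x.
Proof.
move=> Tlin xab.
have := Tlin c _ _ (polyC_fun_poly p) (polyC_fun_poly 0) x xab.
by rewrite polyC_fun_linear addr0 (linear_on_polyfun0 Tlin xab) addr0.
Qed.

(** Linearity of T rewrites the right-hand side of an equation only on the
    interval, and the equation looks at it only there. *)
Lemma L_equation_congr u f g : {in `]a, b[, f =1 g} ->
  L_equation a b q u f -> L_equation a b q u g.
Proof.
move=> fg [w [w1 w2 wae]]; exists w; split=> //.
apply: (@filterS _ _ (ae_filter_ringOfSetsType _)) wae => x Hx xab.
by rewrite Hx // fg.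
Qed.

(** The equations of an L-base are the transmutation identity at monomials. *)
Lemma transmutation_L_base : transmutation a b q T ->
  L_base a b q (fun k => T (monomial k)).
Proof.
move=> [Tlin HT].
have key k : L_equation a b q (T (monomial k))
    (fun x => (k * (k - 1))%N%:R * T (monomial (k - 2)) x).
  rewrite !monomialE.
  have [_] := HT _ (polyC_fun_poly 'X^k); apply: L_equation_congr => x xab.
  have xab' : x \in `[a, b] by apply: subset_itv_oo_cc.
  rewrite cderiven2_polyC -linear_on_polyfunZ // derivnXn -scaler_nat.
  by rewrite ffactnS ffactn1 subn1 subn2.
split=> [k|k k2|k _]; last exact: key.
  by rewrite monomialE; have [] := HT _ (polyC_fun_poly 'X^k).
apply: L_equation_congr (key k) => x _.
by case: k k2 => [|[|//]] _; rewrite ?mul0n ?subnn ?muln0 mul0r.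
Qed.

End Transmutation.

Section Composition.
Local Open Scope classical_set_scope.
Local Open Scope ring_scope.
Context {R : realType}.

(** Each component of c z is a real linear combination of the components of z,
    so the difference quotients of c g combine those of g.  The equality of f
    and c g is required on D only, since linearity of T is an identity on
    [a, b] only. *)
Lemma has_derive_within_scale (D : set R) c f g x : D x ->
  (forall y, D y -> f y = c * g y) ->
  has_derive_within D g x 0 -> has_derive_within D f x 0.
Proof.
move=> Dx fg [gr gi].
have part (c1 c2 : R) (h : R[i] -> R) :
    (forall z, h (c * z) = c1 * complex.Re z + c2 * complex.Im z) ->
  (fun y => (h (f y) - h (f x)) / (y - x)) @ within D x^' --> (0 : R).
  move=> hE.
  have : (fun y => c1 * ((re_fun g y - re_fun g x) / (y - x))
       + c2 * ((im_fun g y - im_fun g x) / (y - x))) @ within D x^' --> (0 : R).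
    rewrite -[X in _ --> X]addr0 -[X in _ --> X + _](mulr0 c1).
    rewrite -[X in _ --> _ + X](mulr0 c2).
    by apply: cvgD; apply: cvgMr.
  apply: cvg_trans; apply: near_eq_cvg.
  near=> y; have Dy : D y by near: y; exact: withinT.
  rewrite !fg // !hE /re_fun /im_fun !mulrA -mulrDl; congr (_ / _).
  by rewrite !mulrBr addrACA -opprD.
split.
- apply: (part (complex.Re c) (- complex.Im c)) => -[u v] /=.
  by case: c {fg part} => c d /=; rewrite mulNr.
- apply: (part (complex.Im c) (complex.Re c)) => -[u v] /=.
  by case: c {fg part} => c d /=; rewrite addrC.
Unshelve. all: by end_near.
Qed.

Lemma standard_transmutation_comp (a b : R) (q : R -> R[i])
    (T B : (R -> R[i]) -> (R -> R[i])) (beta : {poly R[i]} -> {poly R[i]}) :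
  a <= 0 <= b ->
  (forall p, B (polyC_fun p) = polyC_fun (beta p)) ->
  linear beta ->
  (forall p, beta p^`(2) = (beta p)^`(2)) ->
  (forall k, (2 <= k)%N -> exists c m, (2 <= m)%N /\ beta 'X^k = c *: 'X^m) ->
  standard_transmutation a b q T -> standard_transmutation a b q (T \o B).
Proof.
move=> ab0 BE beta_lin beta_deriv beta_Xn [[Tlin HT] [_ Tstd]].
have TBtr : transmutation a b q (T \o B).
  split=> [c u v [p ->] [r ->] x xab|u [p ->]].
    rewrite polyC_fun_linear /= !BE beta_lin -polyC_fun_linear.
    by apply: Tlin => //; exact: polyC_fun_poly.
  rewrite cderiven2_polyC /= !BE beta_deriv -cderiven2_polyC.
  exact/HT/polyC_fun_poly.
split=> //; split=> [|k k2]; first exact: transmutation_L_base.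
have [c [m [m2 betaE]]] := beta_Xn k k2.
have TBE y : y \in `[a, b] -> (T \o B) (monomial k) y = c * T (monomial m) y.
  by move=> yab; rewrite /= !monomialE BE betaE (linear_on_polyfunZ _ _ Tlin).
have z0 : 0 \in `[a, b] by rewrite in_itv.
have [Tm0 Tm'0] := Tstd m m2.
split; first by rewrite TBE // Tm0 mulr0.
exact: has_derive_within_scale z0 TBE Tm'0.
Qed.

End Composition.

(** * The four operators *)

Section FourOperators.
Context {R : realType}.
Implicit Types p : {poly R[i]}.

Lemma Pplus_polyC p : Pplus (polyC_fun p) = polyC_fun (parity_part false p).
Proof.
apply/funext => x.
by rewrite /polyC_fun horner_parity_part mul1r -rmorphN.
Qed.

Lemma Pminus_polyC p : Pminus (polyC_fun p) = polyC_fun (parity_part true p).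
Proof.
apply/funext => x.
by rewrite /polyC_fun horner_parity_part mulN1r -rmorphN.
Qed.

Lemma Aop_polyC p : Aop (polyC_fun p) = polyC_fun (antideriv p).
Proof.
apply/funext => x; rewrite /Aop -{1}[p]antiderivK ointegral_deriv.
rewrite [X in _ - X](_ : _ = 0) ?subr0 //.
by rewrite /polyC_fun horner_coef0 coef_antideriv invr0 mulr0.
Qed.

End FourOperators.

Theorem theorem17 (R : realType) (a b : R) (q : R -> R[i])
    (T : (R -> R[i]) -> (R -> R[i])) :
  a < b -> a <= 0 <= b -> L1 a b q ->
  standard_transmutation a b q T ->
  [/\ standard_transmutation a b q (T \o Pplus),
      standard_transmutation a b q (T \o Pminus),
      standard_transmutation a b q (T \o Aop \o Pplus) &
      standard_transmutation a b q (T \o cderive \o Pminus)].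
Proof.
move=> _ ab0 _ HT.
have parity_deriv2 e (p : {poly R[i]}) :
    parity_part e p^`(2) = (parity_part e p)^`(2).
  by rewrite !derivnS !derivn0 !parity_part_deriv negbK.
split.
- apply: (standard_transmutation_comp ab0 Pplus_polyC) => //.
  + exact: parity_part_linear.
  + by move=> k k2; rewrite parity_partXn; exists (odd k == false)%:R, k.
- apply: (standard_transmutation_comp ab0 Pminus_polyC) => //.
  + exact: parity_part_linear.
  + by move=> k k2; rewrite parity_partXn; exists (odd k == true)%:R, k.
- rewrite -compA.
  apply: (standard_transmutation_comp (beta := antideriv \o parity_part false))
    => //.
  + by move=> p /=; rewrite Pplus_polyC Aop_polyC.
  + by move=> c p1 p2 /=; rewrite parity_part_linear antideriv_linear.
  + exact: antideriv_even_derivn2.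
  + move=> k k2 /=; rewrite parity_partXn.
    exists ((odd k == false)%:R / k.+1%:R), k.+1; split; first exact: leqW.
    by rewrite antiderivZ antiderivXn scalerA.
- rewrite -compA.
  apply: (standard_transmutation_comp (beta := deriv \o parity_part true))
    => //.
  + by move=> p /=; rewrite Pminus_polyC cderive_polyC.
  + by move=> c p1 p2 /=; rewrite parity_part_linear derivD derivZ.
  + by move=> p /=; rewrite parity_deriv2.
  + move=> k k2 /=; rewrite parity_partXn derivZ derivXn.
    rewrite -[_ *+ k]scaler_nat scalerA.
    (* x^2 is killed, so that the exponent 2 may be chosen for its image. *)
    case: k k2 => [|[|[|k]]] // _.
      by exists 0, 2%N; rewrite mul0r !scale0r.
    by exists ((odd k.+3 == true)%:R * k.+3%:R), k.+2.
Qed.
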